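(* Let $P>0$, $\sigma_n^2>0$, let $L_p,L_d\ge 1$ be integers, and let $Q_0\in[0,P]$. For $\rho_p,\rho_d\in[0,1]$ put $$\sigma_e^2=\sigma_e^2(\rho_p)=\frac{\sigma_n^2}{\sigma_n^2+\rho_pPL_p},\qquad \mathrm{SNR}_{\mathrm{eff}}(\rho_p,\rho_d)=\frac{\rho_dP(1-\sigma_e^2)}{\sigma_n^2+\rho_dP\sigma_e^2},$$ $$Q(\rho_p,\rho_d)=\frac{(1-\rho_p)PL_p+(1-\rho_d)PL_d}{L_p+L_d}.$$ Consider the optimization problem P1: maximize $\mathrm{SNR}_{\mathrm{eff}}(\rho_p,\rho_d)$ over $(\rho_p,\rho_d)\in[0,1]^2$ subject to $Q(\rho_p,\rho_d)=Q_0$. Then the optimal solution of P1 is $(\rho_p^*,\rho_d^* )$ given by $$\rho_p^*=\begin{cases}\rho_{p,lb}, & \text{if }\rho_{p,r}<\rho_{p,lb},\\ \rho_{p,r}, & \text{if }\rho_{p,lb}\le\rho_{p,r}\le\rho_{p,ub},\\ \rho_{p,ub}, & \text{if }\rho_{p,r}>\rho_{p,ub},\end{cases}\qquad \rho_d^*=1-\frac{Q_0(L_p+L_d)}{PL_d}+(1-\rho_p^* )\frac{L_p}{L_d},$$ where $$\rho_{p,lb}=\max\Big\{0,\,1-\frac{Q_0(L_p+L_d)}{PL_p}\Big\},\qquad \rho_{p,ub}=\min\Big\{1,\,1-\frac{Q_0(L_p+L_d)}{PL_p}+\frac{L_d}{L_p}\Big\},$$ $$\rho_{p,r}=\begin{cases}\dfrac{L_p+1}{2L_p}\Big(1-\dfrac{Q_0}{P}\Big),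 & \text{if }L_d=1,\\[2mm] \dfrac{L_d+\kappa-\sqrt{L_d(\kappa+L_d)(\kappa+1)}}{L_p(1-L_d)P/\sigma_n^2}, & \text{if }L_d>1,\end{cases}\qquad \kappa=\frac{P-Q_0}{\sigma_n^2}(L_d+L_p).$$
   Context: Interpretation: $P$ is the transmit power, $\sigma_n^2$ the receiver noise variance, $L_p$ and $L_d$ the numbers of pilot and data symbols per block, $\rho_p$ and $\rho_d$ the constant (non-adaptive) power-splitting ratios in the training and data phases (fraction of received power used for channel estimation or data detection, respectively, the rest being harvested). The channel gain has unit variance, the energy conversion efficiency is taken to be $1$, $\sigma_e^2$ is the variance of the MMSE channel estimation error, $Q$ is the average harvested power per symbol, and $Q_0$ is the required average harvested power. *)

(* Defs.v *)
From mathcomp Require Import all_boot all_order all_algebra.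
From mathcomp Require Import reals.

Set Implicit Arguments.
Unset Strict Implicit.
Unset Printing Implicit Defensive.

Import Order.TTheory GRing.Theory Num.Theory.
Local Open Scope ring_scope.

(* Throughout, P is the transmit power, sn2 is the noise variance sigma_n^2
   itself (not the standard deviation), Lp and Ld are the numbers of pilot and
   data symbols, and rp, rd are the power-splitting ratios rho_p, rho_d. *)

(* sigma_e^2: MMSE channel estimation error variance, for a unit-variance
   channel. *)
Definition err_var (R : realType) (P sn2 : R) (Lp : nat) (rp : R) : R :=
  sn2 / (sn2 + rp * P * Lp%:R).

Definition snr_eff (R : realType) (P sn2 : R) (Lp : nat) (rp rd : R) : R :=
  rd * P * (1 - err_var P sn2 Lp rp) / (sn2 + rd * P * err_var P sn2 Lp rp).

(* Average harvested power per symbol, at unit energy conversion efficiency. *)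
Definition harvested (R : realType) (P : R) (Lp Ld : nat) (rp rd : R) : R :=
  ((1 - rp) * P * Lp%:R + (1 - rd) * P * Ld%:R) / (Lp%:R + Ld%:R).

Definition P1_feasible (R : realType) (P Q0 : R) (Lp Ld : nat)
    (x : R * R) : Prop :=
  [/\ 0 <= x.1 <= 1, 0 <= x.2 <= 1 & harvested P Lp Ld x.1 x.2 = Q0].

Definition P1_optimal (R : realType) (P sn2 Q0 : R) (Lp Ld : nat)
    (x : R * R) : Prop :=
  P1_feasible P Q0 Lp Ld x /\
  forall y : R * R, P1_feasible P Q0 Lp Ld y ->
    snr_eff P sn2 Lp y.1 y.2 <= snr_eff P sn2 Lp x.1 x.2.

Definition kappa (R : realType) (P sn2 Q0 : R) (Lp Ld : nat) : R :=
  (P - Q0) / sn2 * (Ld%:R + Lp%:R).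

Definition rho_p_lb (R : realType) (P Q0 : R) (Lp Ld : nat) : R :=
  Num.max 0 (1 - Q0 * (Lp%:R + Ld%:R) / (P * Lp%:R)).

Definition rho_p_ub (R : realType) (P Q0 : R) (Lp Ld : nat) : R :=
  Num.min 1 (1 - Q0 * (Lp%:R + Ld%:R) / (P * Lp%:R) + Ld%:R / Lp%:R).

(* Only meant for 0 < Ld, so that the last branch is the case 1 < Ld. *)
Definition rho_p_r (R : realType) (P sn2 Q0 : R) (Lp Ld : nat) : R :=
  let k := kappa P sn2 Q0 Lp Ld in
  if Ld == 1%N then (Lp%:R + 1) / (2 * Lp%:R) * (1 - Q0 / P)
  else (Ld%:R + k - Num.sqrt (Ld%:R * (k + Ld%:R) * (k + 1))) /
       (Lp%:R * (1 - Ld%:R) * P / sn2).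

Definition rho_p_star (R : realType) (P sn2 Q0 : R) (Lp Ld : nat) : R :=
  let lb := rho_p_lb P Q0 Lp Ld in
  let ub := rho_p_ub P Q0 Lp Ld in
  let r := rho_p_r P sn2 Q0 Lp Ld in
  if r < lb then lb else if r <= ub then r else ub.

Definition rho_d_star (R : realType) (P sn2 Q0 : R) (Lp Ld : nat) : R :=
  1 - Q0 * (Lp%:R + Ld%:R) / (P * Ld%:R)
    + (1 - rho_p_star P sn2 Q0 Lp Ld) * (Lp%:R / Ld%:R).

(* Main.v *)
Require Import Defs.
From mathcomp Require Import all_boot all_order all_algebra.
From mathcomp Require Import reals.
From mathcomp Require Import ring lra.

(** In the variable s = rho_p P L_p / sigma_n^2 the constraint Q = Q_0 says that
    rho_d P L_d / sigma_n^2 = kappa - s, and the objective becomes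
    g(s) = s (kappa - s) / (L_d + kappa + (L_d - 1) s).  For two points c, s the
    difference g(c) - g(s) has the sign of (c - s) h(c, s), where
    h(c, s) = (L_d + kappa) (kappa - c - s) - (L_d - 1) c s decreases strictly in
    each argument.  Since s_r = rho_{p,r} P L_p / sigma_n^2 is the nonnegative
    solution of h(s, s) = 0, g increases strictly before s_r and decreases
    strictly after it, so the unique maximizer on an interval is the projection
    of s_r onto it. *)

Set Implicit Arguments.
Unset Strict Implicit.
Unset Printing Implicit Defensive.

Import Order.TTheory GRing.Theory Num.Theory.
Local Open Scope ring_scope.

Definition gain {R : realType} (k L s : R) : R :=
  s * (k - s) / (L + k + (L - 1) * s).

Lemma gain_lt (R : realType) (k L r c s : R) :
  0 <= k -> 1 <= L -> 0 <= r -> 0 <= c -> 0 <= s ->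
  (L + k) * (k - r - r) = (L - 1) * (r * r) ->
  (s < c <= r) || (r <= c < s) -> gain k L s < gain k L c.
Proof.
move=> k0 L1 r0 c0 s0 hr hcs; rewrite /gain.
have B0 : 0 < L + k by lra.
have D0 x : 0 <= x -> 0 < L + k + (L - 1) * x.
  by move=> x0; rewrite ltr_pwDl// mulr_ge0//; lra.
rewrite ltr_pdivrMr ?D0// mulrAC ltr_pdivlMr ?D0// -subr_gt0.
have -> : c * (k - c) * (L + k + (L - 1) * s)
          - s * (k - s) * (L + k + (L - 1) * c)
        = (c - s) * ((L + k) * (k - c - s) - (L - 1) * (c * s)) by ring.
(* Either way the second factor is compared with its value 0 at [c = s = r]. Strictness comes from
   the linear term, since [L - 1] may vanish. *)
case/orP: hcs => /andP[h1 h2].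
- have h : c * s <= r * r by rewrite ler_pM//; lra.
  have h3 : (L - 1) * (c * s) <= (L - 1) * (r * r) by rewrite ler_wpM2l//; lra.
  have h4 : (L + k) * (k - r - r) < (L + k) * (k - c - s).
    by rewrite ltr_pM2l//; lra.
  by rewrite mulr_gt0//; lra.
- have h : r * r <= c * s by rewrite ler_pM//; lra.
  have h3 : (L - 1) * (r * r) <= (L - 1) * (c * s) by rewrite ler_wpM2l//; lra.
  have h4 : (L + k) * (k - c - s) < (L + k) * (k - r - r).
    by rewrite ltr_pM2l//; lra.
  by rewrite nmulr_rgt0; lra.
Qed.

Section Problem.
Variables (R : realType) (P sn2 Q0 : R) (Lp Ld : nat).
Hypotheses (hP : 0 < P) (hsn2 : 0 < sn2) (hLp : (1 <= Lp)%N) (hLd : (1 <= Ld)%N).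
Hypothesis hQ0 : 0 <= Q0 <= P.

Let Lp0 : 0 < Lp%:R :> R. Proof. by rewrite ltr0n. Qed.
Let Ld1 : 1 <= Ld%:R :> R. Proof. by rewrite ler1n. Qed.
Let Ld0 : 0 < Ld%:R :> R. Proof. by rewrite ltr0n. Qed.

Let nz : (P != 0) * (sn2 != 0) * (Lp%:R != 0 :> R) * (Ld%:R != 0 :> R) *
         (Lp%:R + Ld%:R != 0 :> R).
Proof. by rewrite !lt0r_neq0// addr_gt0. Qed.

Let a : R := Lp%:R * P / sn2.
Let a0 : 0 < a. Proof. by rewrite divr_gt0// mulr_gt0. Qed.

Let k := kappa P sn2 Q0 Lp Ld.

Lemma kappa_ge0 : 0 <= k.
Proof.
case/andP: hQ0 => _ QP.
by rewrite /k /kappa mulr_ge0 ?divr_ge0 ?subr_ge0 ?addr_ge0 // ?ltW.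
Qed.

Definition rho_d_of (rp : R) : R :=
  1 - Q0 * (Lp%:R + Ld%:R) / (P * Ld%:R) + (1 - rp) * (Lp%:R / Ld%:R).

Lemma harvested_eq (rp rd : R) :
  harvested P Lp Ld rp rd = Q0 <-> rd = rho_d_of rp.
Proof.
rewrite /harvested /rho_d_of; split => [<- | ->]; field; rewrite ?nz//.
Qed.

(** As [rho_d_of] is affine of slope [- Lp / Ld], [0 <= x.2] becomes the second argument of the
    [min] in [rho_p_ub], and [x.2 <= 1] that of the [max] in [rho_p_lb]. *)
Lemma P1_feasibleE (x : R * R) :
  P1_feasible P Q0 Lp Ld x <->
  rho_p_lb P Q0 Lp Ld <= x.1 <= rho_p_ub P Q0 Lp Ld /\ x.2 = rho_d_of x.1.
Proof.
have hd rp : rho_d_of rp =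
    (1 - Q0 * (Lp%:R + Ld%:R) / (P * Lp%:R) + Ld%:R / Lp%:R - rp)
      * (Lp%:R / Ld%:R) by rewrite /rho_d_of; field; rewrite ?nz//.
have hd1 rp : 1 - rho_d_of rp =
    (rp - (1 - Q0 * (Lp%:R + Ld%:R) / (P * Lp%:R))) * (Lp%:R / Ld%:R).
  by rewrite /rho_d_of; field; rewrite ?nz//.
have q0 : 0 < Lp%:R / Ld%:R :> R by rewrite divr_gt0.
have box rp : (0 <= rho_d_of rp <= 1) =
    (rp <= 1 - Q0 * (Lp%:R + Ld%:R) / (P * Lp%:R) + Ld%:R / Lp%:R) &&
    (1 - Q0 * (Lp%:R + Ld%:R) / (P * Lp%:R) <= rp).
  by rewrite -[rho_d_of rp <= 1]subr_ge0 hd1 hd !pmulr_lge0// !subr_ge0.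
rewrite /P1_feasible /rho_p_lb /rho_p_ub ge_max le_min; split.
- move=> [/andP[-> ->] h2 /harvested_eq e]; split=> //.
  by move: h2; rewrite e box => /andP[-> ->].
- move=> [/andP[/andP[-> h1] /andP[-> h2]] e]; split=> //.
    by rewrite e box h1 h2.
  by apply/harvested_eq.
Qed.

Lemma snr_eff_feasible (rp rd : R) : P1_feasible P Q0 Lp Ld (rp, rd) ->
  snr_eff P sn2 Lp rp rd = gain k Ld%:R (a * rp).
Proof.
move=> [/= /andP[rp0 _] /andP[rd0 _] /harvested_eq e].
have h1 : 0 < sn2 + rp * P * Lp%:R.
  by rewrite ltr_wpDr// !mulr_ge0// ltW.
have h2 : 0 <= rd * P by rewrite mulr_ge0// ltW.
have h3 : sn2 + rp * P * Lp%:R + rd * P != 0.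
  by rewrite lt0r_neq0// ltr_wpDr.
(* Eliminating [k] instead of [rd] makes both denominators equal to the sum in [h3] up to nonzero
   factors. *)
have kE : k = a * rp + rd * P * Ld%:R / sn2.
  by rewrite e /k /kappa /a /rho_d_of; field; rewrite ?nz.
rewrite /snr_eff /gain /err_var kE /a; field.
rewrite !nz (lt0r_neq0 h1) /=; apply/andP; split.
- rewrite (_ : _ + _ = Ld%:R * (sn2 + rp * P * Lp%:R + rd * P)); last by ring.
  by rewrite mulf_neq0 ?nz.
- rewrite (_ : _ + _ = sn2 * (sn2 + rp * P * Lp%:R + rd * P)); last by ring.
  by rewrite mulf_neq0 ?nz.
Qed.

Lemma rho_p_lb_le_ub : rho_p_lb P Q0 Lp Ld <= rho_p_ub P Q0 Lp Ld.
Proof.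
case/andP: hQ0 => Q00 QP.
rewrite /rho_p_lb /rho_p_ub ge_max !le_min ler01 lerDl gerBl.
have -> : 1 - Q0 * (Lp%:R + Ld%:R) / (P * Lp%:R) + Ld%:R / Lp%:R
        = (P - Q0) * (Lp%:R + Ld%:R) / (P * Lp%:R) by field; rewrite ?nz//.
by rewrite !divr_ge0 ?mulr_ge0 ?subr_ge0 ?addr_ge0 // ?ltW.
Qed.

(** For [Ld = 1] the equation is linear with root [k / 2]. Otherwise it is quadratic, and the root
    with [+ sqrt] is nonnegative because [k >= 0]. *)
Lemma rho_p_r_stationary (r := a * rho_p_r P sn2 Q0 Lp Ld) :
  0 <= r /\
  (Ld%:R + k) * (k - r - r) = (Ld%:R - 1) * (r * r).
Proof.
have k0 := kappa_ge0; have L1 := Ld1.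
rewrite /r /rho_p_r -/k; case: eqP => [LE | /eqP LN].
- have -> : a * ((Lp%:R + 1) / (2 * Lp%:R) * (1 - Q0 / P)) = k / 2.
    by rewrite /a /k /kappa LE; field; rewrite -?LE ?nz//.
  by rewrite LE; split; [lra | field].
- have L2 : 1 < Ld%:R :> R by rewrite ltr1n ltn_neqAle eq_sym LN.
  set q := Num.sqrt _.
  have qq : q * q = Ld%:R * (k + Ld%:R) * (k + 1).
    by rewrite -expr2 sqr_sqrtr// !mulr_ge0//; lra.
  have qge : Ld%:R + k <= q.
    rewrite -(@ler_pXn2r _ 2)// ?nnegrE ?sqrtr_ge0//; last lra.
    rewrite [X in _ <= X]expr2 qq -subr_ge0.
    have -> : Ld%:R * (k + Ld%:R) * (k + 1) - (Ld%:R + k) ^+ 2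
            = (Ld%:R + k) * ((Ld%:R - 1) * k) by ring.
    by apply: mulr_ge0; [|apply: mulr_ge0]; lra.
  (* Both signs are flipped, so that the denominator is positive and [qge] bounds the numerator. *)
  have -> : a * ((Ld%:R + k - q) / (Lp%:R * (1 - Ld%:R) * P / sn2))
          = (q - (Ld%:R + k)) / (Ld%:R - 1).
    by rewrite /a; field; rewrite ?nz//; lra.
  split; first by rewrite divr_ge0//; lra.
  apply: (@mulIf _ (Ld%:R - 1)); first lra.
  (* The middle term is the expanded square of [q - (Ld%:R + k)]. *)
  transitivity (q * q - 2 * q * (Ld%:R + k) + (Ld%:R + k) ^+ 2).
    by rewrite qq; field; rewrite ?nz//; lra.
  by field; rewrite ?nz//; lra.
Qed.

Lemma rho_p_star_feasible :
  P1_feasible P Q0 Lp Ld (rho_p_star P sn2 Q0 Lp Ld, rho_d_star P sn2 Q0 Lp Ld).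
Proof.
(* [rho_d_star] is [rho_d_of] at [rho_p_star] by conversion, so only the bounds remain. *)
apply/P1_feasibleE; split => //=; have lbub := rho_p_lb_le_ub.
by rewrite /rho_p_star; case: ltP => h1; [|case: ifPn => h2]; lra.
Qed.

Lemma snr_eff_lt_star (rp rd : R) : P1_feasible P Q0 Lp Ld (rp, rd) ->
  (rp, rd) <> (rho_p_star P sn2 Q0 Lp Ld, rho_d_star P sn2 Q0 Lp Ld) ->
  snr_eff P sn2 Lp rp rd <
  snr_eff P sn2 Lp (rho_p_star P sn2 Q0 Lp Ld) (rho_d_star P sn2 Q0 Lp Ld).
Proof.
move=> fy ny; have fs := rho_p_star_feasible.
rewrite (snr_eff_feasible fy) (snr_eff_feasible fs) /=.
have [r0 hr] := rho_p_r_stationary.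
have [/= /andP[y0 _] _ _] := fy; have [/= /andP[s0 _] _ _] := fs.
have a_ge0 := ltW a0.
apply: (gain_lt kappa_ge0 Ld1 r0 (mulr_ge0 a_ge0 s0) (mulr_ge0 a_ge0 y0) hr).
rewrite !(ltr_pM2l a0) !(ler_pM2l a0).
have [/= /andP[lby yub] ey] := (P1_feasibleE _).1 fy.
(* The constraint determines [rd] from [rp], so distinct feasible pairs differ in the first
   component. *)
have : rp != rho_p_star P sn2 Q0 Lp Ld.
  by apply/eqP => e; apply: ny; rewrite ey e.
(* In all three cases the projection lies between [rho_p_r] and [rp], and differs from [rp]. *)
rewrite /rho_p_star; case: ltP => h1; [|case: ifPn => h2].
all: by rewrite neq_lt => /orP[] h; apply/orP; lra.
Qed.

End Problem.

Theorem proposition1 (R : realType) (P sn2 Q0 : R) (Lp Ld : nat)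
    (hP : 0 < P) (hsn2 : 0 < sn2) (hLp : (1 <= Lp)%N) (hLd : (1 <= Ld)%N)
    (hQ0 : 0 <= Q0 <= P) (x : R * R) :
  P1_optimal P sn2 Q0 Lp Ld x <->
  x = (rho_p_star P sn2 Q0 Lp Ld, rho_d_star P sn2 Q0 Lp Ld).
Proof.
have fs := rho_p_star_feasible hP hsn2 hLp hLd hQ0.
have lt_star := snr_eff_lt_star hP hsn2 hLp hLd hQ0.
split=> [[fx hx] | ->]; first case: x fx hx => rp rd fx hx.
- apply/eqP/negPn/negP => /eqP nx.
  by have := lt_star _ _ fx nx; rewrite ltNge (hx _ fs).
- split=> // -[rp rd] fy.
  have [-> // | /eqP ny] := eqVneq (rp, rd)
    (rho_p_star P sn2 Q0 Lp Ld, rho_d_star P sn2 Q0 Lp Ld).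
  exact/ltW/lt_star.
Qed.
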